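(* Let $\tilde f:2^{\mathcal N}\to\mathbb Z$ be the rank function of the integral polymatroid $P_{\tilde f}$ obtained from the quantization with $M$ divisions described in the context, and let $\beta>0$. Suppose surrogate marginal utility vectors $\hat V_n=(\hat v_{n1},\dots,\hat v_{n\tilde f(\{n\})})$, $n\in\mathcal N$, are given. Then for any concave and non-decreasing functions $u_1,\dots,u_N$ such that, for each $n$, $u_n(\frac{y_n}{M})=\sum_{m=1}^{y_n}\hat v_{nm}+\frac{\beta y_n}{M}$ for all integers $0\le y_n\le\tilde f(\{n\})$, the vector $\mathbf y^*(\hat V)$ returned by the greedy allocation algorithm (with ties broken arbitrarily) is an optimal solution of $\max_{\mathbf y\in P_{\tilde f}}\sum_{n=1}^N u_n(\frac{y_n}{M})$, and $$\max_{\mathbf y\in P_{\tilde f}}\sum_{n=1}^N u_n\Big(\frac{y_n}{M}\Big)=\sum_{n=1}^N u_n\Big(\frac{y_n^*(\hat V)}{M}\Big)=\mathrm{OPT}(\hat V)+\beta,$$ where $\mathrm{OPT}(\hat V)=\sum_{n=1}^N\sum_{m=1}^{y_n^*(\hat V)}\hat v_{nm}$.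
   Context: Setting: $\mathcal N=\{1,\dots,N\}$, $N\ge2$. $f:2^{\mathcal N}\to\mathbb R$ is normalized ($f(\emptyset)=0$), monotone, submodular, with $f(\mathcal N)=1$ and strictly positive minimum distance $\triangle f=\min_{S\subseteq\mathcal N}\min_{i\ne j\in\mathcal N\setminus S}|f(S\cup\{i\})+f(S\cup\{j\})-f(S)-f(S\cup\{i,j\})|$. $M$ is an integer with $M\ge 2/\triangle f$, $\tilde f(S)=\lfloor f(S)M\rfloor$, and $P_{\tilde f}=\{\mathbf y\in\mathbb N^N:\sum_{n\in S}y_n\le\tilde f(S)\ \forall S\subseteq\mathcal N\}$; $\tilde f$ is then integer-valued, normalized, monotone and submodular, with $\tilde f(\mathcal N)=M$. Each $\hat V_n$ is a non-increasing list (as is forced by concavity of $u_n$). Greedy allocation algorithm: start with $\mathbf y=\mathbf 0$. At each step let $J(\mathbf y)$ be the set of agents $i$ such that $(y_i+1,y_{-i})\in P_{\tilde f}$, where $(y_i+1,y_{-i})$ is $\mathbf y$ with its $i$-th coordinate increased by one. If $J(\mathbf y)$ is empty, stop and return $\mathbf y^*(\hat V)=\mathbf y$. Otherwise choose $n\in J(\mathbf y)$ maximizing the next unused bid $\hat v_{i,y_i+1}$ over $i\in J(\mathbf y)$ (ties broken arbitrarily), increase $y_n$ by one, and repeat. *)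

(* Defs.v *)
From mathcomp Require Import all_boot all_order all_algebra.
From mathcomp Require Import boolp classical_sets set_interval reals topology.
From mathcomp Require Import convex.

Set Implicit Arguments.
Unset Strict Implicit.
Unset Printing Implicit Defensive.

Import Order.TTheory GRing.Theory Num.Theory.

Local Open Scope ring_scope.

Section SetFunctions.
Variables (R : realType) (N : nat).
Implicit Types (f : {set 'I_N} -> R) (S T : {set 'I_N}).

Definition normalized f := f finset.set0 = 0.

Definition monotone f := forall S T, S \subset T -> f S <= f T.

Definition submodular f :=
  forall S T, f (S :|: T) + f (S :&: T) <= f S + f T.

(* For 2 <= N the infimum is taken over a finite nonempty set of values, so it
   is the minimum. *)
Definition min_distance f : R :=
  inf (fun r : R => exists S (i j : 'I_N),
    [/\ i != j, i \notin S, j \notin S &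
      r = `| f (i |: S) + f (j |: S) - f S - f (i |: (j |: S)) |]).

Definition quantization f (M : int) S : int := Num.floor (f S * M%:~R).

End SetFunctions.

Section Allocation.
Variable N : nat.
Implicit Types (F : {set 'I_N} -> int) (y : {ffun 'I_N -> nat}) (n : 'I_N).

Definition polymatroid F : pred {ffun 'I_N -> nat} :=
  [pred y : {ffun 'I_N -> nat} |
    [forall S : {set 'I_N}, \sum_(n in S) (y n)%:Z <= F S]].

Definition incr n y : {ffun 'I_N -> nat} := [ffun i => (y i + (i == n))%N].

Definition incrementable F y : {set 'I_N} :=
  finset (fun i : 'I_N => incr i y \in polymatroid F).

Variable R : realType.
Implicit Type V : 'I_N -> seq R.

(* The bids of agent n are numbered from 1, whereas sequences are indexed from
   0. *)
Definition bid V n (m : nat) : R := (V n)`_m.-1.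

(* [greedy_from F V y y'] : some execution of the algorithm (for some way of
   breaking ties) started from the current allocation y returns y'. *)
Inductive greedy_from F V : {ffun 'I_N -> nat} -> {ffun 'I_N -> nat} -> Prop :=
| GreedyStop y :
    incrementable F y = finset.set0 -> greedy_from F V y y
| GreedyStep y n y' :
    n \in incrementable F y ->
    (forall i, i \in incrementable F y -> bid V i (y i).+1 <= bid V n (y n).+1) ->
    greedy_from F V (incr n y) y' ->
    greedy_from F V y y'.

Definition greedy_returns F V y' := greedy_from F V [ffun => 0%N] y'.

Definition OPT V y : R := \sum_(n < N) \sum_(1 <= m < (y n).+1) bid V n m.

Definition welfare (u : 'I_N -> R -> R) (M : int) y : R :=
  \sum_(n < N) u n ((y n)%:R / M%:~R).

Definition optimal_solution F (obj : {ffun 'I_N -> nat} -> R) y :=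
  y \in polymatroid F /\ (forall z, z \in polymatroid F -> obj z <= obj y).

(* The supremum is a maximum as soon as an optimal solution exists. *)
Definition max_value F (obj : {ffun 'I_N -> nat} -> R) : R :=
  sup (fun r : R => exists2 y, y \in polymatroid F & r = obj y).

Lemma sum_incr n y : (\sum_i incr n y i = (\sum_i y i).+1)%N.
Proof.
under eq_bigr do rewrite ffunE.
have sum1 : (\sum_(i < N) (i == n) = 1)%N.
  by rewrite (bigD1 n) //= eqxx big1 // => i /negPf ->.
by rewrite big_split /= sum1 addn1.
Qed.

Lemma polymatroid_sum F y :
  y \in polymatroid F -> (\sum_i y i)%N%:Z <= F finset.setT.
Proof.
move=> /forallP /(_ finset.setT); apply: le_trans.
rewrite (big_morph Posz PoszD (erefl 0%:Z)) le_eqVlt; apply/orP; left; apply/eqP.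
by apply: eq_bigl => i; rewrite finset.in_setT.
Qed.

Lemma greedy_from_total F V y : exists y', greedy_from F V y y'.
Proof.
pose b := `|F finset.setT|%N; have [k] := ubnP (b.+1 - \sum_i y i)%N.
elim: k y => // k IHk y ltk.
have [J0|[j Jj]] := finset.set_0Vmem (incrementable F y).
  by exists y; apply: GreedyStop.
have [n Jn nmax] := @Order.TotalTheory.arg_maxP _ R _ j
  (mem (incrementable F y)) (fun i => bid V i (y i).+1) Jj.
have lyb : (\sum_i y i < b)%N.
  rewrite -(sum_incr n) -lez_nat.
  have : n \in incrementable F y by exact: Jn.
  rewrite finset.in_set => /polymatroid_sum /le_trans; apply.
  by rewrite abszE ler_norm.
have [|y' ?] := IHk (incr n y).
  rewrite sum_incr subSS; apply: leq_ltn_trans (_ : (b - \sum_i y i < k)%N) => //.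
  by rewrite subSn ?(ltnW lyb) // ltnS in ltk.
by exists y'; apply: GreedyStep Jn _ _.
Qed.

End Allocation.

Definition concave_function (R : realType) (D : set R) (u : R -> R) :=
  convex_function (D : set R^o) (fun x : R^o => - u x : R^o).

Definition nondecreasing_on (R : realType) (D : set R) (u : R -> R) :=
  {in D &, {homo u : x y / x <= y}}.

(* Main.v *)
Require Import Defs.
From mathcomp Require Import all_boot all_order all_algebra.
From mathcomp Require Import boolp classical_sets set_interval reals topology.
From mathcomp Require Import convex.
From mathcomp Require Import zify lra.

Set Implicit Arguments.
Unset Strict Implicit.
Unset Printing Implicit Defensive.

Import Order.TTheory GRing.Theory Num.Theory.

Local Open Scope ring_scope.

(* Two crossing sets S, T can be shrunk to (S :&: T) + i and (S :&: T) + j, with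
   i in S only and j in T only, without increasing the submodularity gap. Hence
   the gap is at least the minimum distance; after scaling by M it is at least
   2, which absorbs the errors of the two floors, so the quantization is
   submodular. Optimality of greedy is an exchange argument: any feasible z
   above the current allocation y can be moved above the next allocation,
   without losing value, by adding a unit to the chosen agent n and, if that is
   infeasible, removing one from another agent j of the smallest z-tight set
   containing n. When no agent is incrementable, every agent lies in a tight
   set, so the whole ground set is tight and all M units are allocated. *)

(** * Submodularity and monotonicity of the quantization *)

Section Quantization.
Import boot.finset.
Variables (R : realType) (N : nat) (f : {set 'I_N} -> R) (M : int).
Implicit Types S T : {set 'I_N}.

(** Submodularity makes the gap nonnegative, which removes the absolute value in [min_distance]. *)
Lemma min_distance_le S (i j : 'I_N) :
  submodular f -> i != j -> i \notin S -> j \notin S ->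
  min_distance f <= f (i |: S) + f (j |: S) - f S - f (i |: (j |: S)).
Proof.
move=> subf ij iS jS.
have := subf (i |: S) (j |: S).
have -> : (i |: S) :|: (j |: S) = i |: (j |: S).
  by apply/setP => x; rewrite !inE; case: (x == i); case: (x == j); case: (x \in S).
have -> : (i |: S) :&: (j |: S) = S.
  apply/setP => x; rewrite !inE.
  case: (x =P i) => [->|_]; last by case: (x == j); case: (x \in S).
  by rewrite (negPf ij) (negPf iS).
move=> le_f; rewrite -[leRHS]ger0_norm; last by lra.
apply: ge_inf; last by exists S, i, j.
by exists 0 => _ [? [? [? [_ _ _ ->]]]].
Qed.

Lemma min_distance_le_crossing S T :
  submodular f -> ~~ (S \subset T) -> ~~ (T \subset S) ->
  min_distance f <= f S + f T - f (S :|: T) - f (S :&: T).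
Proof.
move=> subf /subsetPn[i iS iT] /subsetPn[j jT jS].
have ij : i != j by apply: contraNneq jS => <-.
have := @min_distance_le (S :&: T) i j subf ij.
rewrite !inE (negPf iT) (negPf jS) andbF => /(_ isT isT).
(* This instance and the one at [j |: S] and [T], added to the bound at [S :&: T], cancel all terms
   but those of the claim. *)
have := subf S (i |: (j |: (S :&: T))).
have -> : S :|: (i |: (j |: (S :&: T))) = j |: S.
  apply/setP => x; rewrite !inE; case: (x =P i) => [->|_]; rewrite ?iS ?orbT //.
  by case: (x == j); case: (x \in S); case: (x \in T).
have -> : S :&: (i |: (j |: (S :&: T))) = i |: (S :&: T).
  apply/setP => x; rewrite !inE; case: (x =P i) => [->|_]; rewrite ?iS //.
  case: (x =P j) => [->|_]; rewrite ?(negPf jS) //.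
  by case: (x \in S); case: (x \in T).
have := subf (j |: S) T.
have -> : (j |: S) :|: T = S :|: T.
  apply/setP => x; rewrite !inE; case: (x =P j) => [->|_]; rewrite ?jT ?orbT //.
have -> : (j |: S) :&: T = j |: (S :&: T).
  by apply/setP => x; rewrite !inE; case: (x =P j) => [->|_]; rewrite ?jT.
lra.
Qed.

Lemma quantization_submodular S T :
  submodular f -> 0 < min_distance f -> 2 / min_distance f <= M%:~R ->
  quantization f M (S :|: T) + quantization f M (S :&: T)
  <= quantization f M S + quantization f M T.
Proof.
move=> subf d0 dM.
case ST: (S \subset T); first by rewrite (setUidPr ST) (setIidPl ST) addrC.
case TS: (T \subset S); first by rewrite (setUidPl TS) (setIidPr TS).
have gap := min_distance_le_crossing subf (negbT ST) (negbT TS).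
have {}dM : 2 <= M%:~R * min_distance f by rewrite -ler_pdivrMr.
have M0 : 0 < M%:~R :> R by rewrite -(pmulr_lgt0 _ d0); apply: lt_le_trans dM.
have gapM : 2 <= f S * M%:~R + f T * M%:~R - f (S :|: T) * M%:~R
              - f (S :&: T) * M%:~R.
  by apply: le_trans dM _; rewrite -mulrDl -!mulrBl [leLHS]mulrC ler_pM2r.
(* Rounding down can only lower the left side, and takes less than 2 off the right side. *)
rewrite -ltzD1 -(ltr_int R) /quantization !intrD.
have := floor_le (f (S :|: T) * M%:~R); have := floor_le (f (S :&: T) * M%:~R).
have := floorD1_gt (f S * M%:~R); have := floorD1_gt (f T * M%:~R).
rewrite !intrD; lra.
Qed.

Lemma quantization_monotone S T :
  monotone f -> 0 <= M -> S \subset T ->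
  quantization f M S <= quantization f M T.
Proof. by move=> mf M0 /mf fST; rewrite le_floor // ler_wpM2r // ler0z. Qed.

End Quantization.

(** * Tight sets and exchanges in an integral polymatroid *)

Section Polymatroid.
Import boot.finset.
Variables (N : nat) (F : {set 'I_N} -> int).
Hypothesis subF : forall S T, F (S :|: T) + F (S :&: T) <= F S + F T.
Implicit Types (S T : {set 'I_N}) (y z : {ffun 'I_N -> nat}) (n : 'I_N).

Definition load y S : int := \sum_(n in S) (y n)%:Z.

Definition tight y S := load y S == F S.

Lemma polymatroidP y :
  reflect (forall S, load y S <= F S) (y \in polymatroid F).
Proof. exact: forallP. Qed.

Lemma loadUI y S T : load y (S :|: T) + load y (S :&: T) = load y S + load y T.
Proof.
rewrite /load !(big_mkcond (fun i => i \in _)) -!big_split /=.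
apply: eq_bigr => i _; rewrite !inE.
by case: (i \in S); case: (i \in T); rewrite /= ?addr0 ?add0r.
Qed.

Lemma load_incr n y S : load (incr n y) S = load y S + (n \in S)%:R.
Proof.
have -> : (n \in S)%:R = \sum_(i in S) (i == n)%:R :> int.
  rewrite big_mkcond /= (bigD1 n) //= eqxx big1 ?addr0; last first.
    by move=> i /negPf ->; case: ifP.
  by case: (n \in S).
rewrite /load -big_split; apply: eq_bigr => i _ /=.
by rewrite ffunE PoszD; case: (i == n).
Qed.

Lemma load_le y z S : (forall i, (y i <= z i)%N) -> load y S <= load z S.
Proof. by move=> yz; apply: ler_sum => i _; rewrite lez_nat. Qed.

Lemma polymatroid_le y z :
  (forall i, (y i <= z i)%N) -> z \in polymatroid F -> y \in polymatroid F.
Proof.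
move=> yz /polymatroidP zP; apply/polymatroidP => S.
exact: le_trans (load_le _ yz) (zP S).
Qed.

Lemma polymatroid_coord y n : y \in polymatroid F -> (y n)%:Z <= F [set n].
Proof. by move/polymatroidP/(_ [set n]); rewrite /load big_set1. Qed.

Lemma incr_ge y z n :
  (forall i, (y i <= z i)%N) -> (y n < z n)%N -> forall i, (incr n y i <= z i)%N.
Proof.
move=> yz ynz i; rewrite ffunE.
by case: eqP => [->|_]; rewrite ?addn1 ?addn0.
Qed.

(** The slack [F S - load y S] is nonnegative and, [load y] being modular, submodular; its zeros are
    thus closed under both operations. *)
Lemma tightUI y S T : y \in polymatroid F -> tight y S -> tight y T ->
  tight y (S :|: T) /\ tight y (S :&: T).
Proof.
move=> /polymatroidP yP /eqP tS /eqP tT; have := subF S T.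
have := loadUI y S T; have := yP (S :|: T); have := yP (S :&: T).
rewrite /tight; move: tS tT; lia.
Qed.

(** A constraint violated by [incr n y] is on a set containing [n] and, by integrality, had no slack
    at [y]. *)
Lemma not_incrementable_tight y n :
  y \in polymatroid F -> n \notin incrementable F y ->
  exists2 S : {set 'I_N}, n \in S & tight y S.
Proof.
move=> /polymatroidP yP; rewrite inE => /forallPn[S].
rewrite -/(load _ S) load_incr -ltNge => FS; exists S; have := yP S; move: FS.
  by case: (n \in S) => //=; lia.
by rewrite /tight; case: (n \in S) => /=; lia.
Qed.

(** A minimal tight set containing [n] is the smallest one, by closure under intersection. *)
Lemma minimal_tight y n :
  y \in polymatroid F -> n \notin incrementable F y ->
  exists T, [/\ n \in T, tight y T &
    forall S, n \in S -> tight y S -> T \subset S].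
Proof.
move=> yP /(not_incrementable_tight yP)[S0 nS0 tS0].
have [T /minsetP[/andP[nT tT] minT] _] :=
  @minset_exists _ (fun S => (n \in S) && tight y S) S0 (introT andP (conj nS0 tS0)).
exists T; split=> // S nS tS; apply/setIidPl/minT; last exact: subsetIl.
by rewrite inE nT nS (tightUI yP tT tS).2.
Qed.

(** The empty set is tight, so a maximal tight set exists; by closure under union it absorbs a tight
    set around each agent. *)
Lemma tight_setT_of_maximal y :
  F set0 = 0 -> y \in polymatroid F -> incrementable F y = set0 ->
  tight y setT.
Proof.
move=> F0 yP J0.
have tight0 : tight y set0 by rewrite /tight /load big_set0 F0.
have [S /maxsetP[tS maxS] _] := @maxset_exists _ (tight y) set0 tight0.
suff -> : setT = S :> {set 'I_N} by [].
apply/eqP; rewrite eqEsubset subsetT andbT; apply/fintype.subsetP => n _.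
have [|T nT tT] := @not_incrementable_tight y n yP; first by rewrite J0 inE.
by rewrite -(maxS _ (tightUI yP tS tT).1 (subsetUl _ _)) inE nT orbT.
Qed.

(** Serves when greedy picks [n] but [z] has no room for it: a unit of [j] is traded for one of [n],
    with [x] as the common part. *)
Lemma exchange y z n :
  z \in polymatroid F -> (forall i, (y i <= z i)%N) -> z n = y n ->
  n \in incrementable F y -> n \notin incrementable F z ->
  exists j x, [/\ z = incr j x, incr n x \in polymatroid F, (y j < z j)%N &
    forall i, (incr n y i <= incr n x i)%N].
Proof.
move=> zP yz zn Jyn Jzn; have [T [nT /eqP tT minT]] := minimal_tight zP Jzn.
(* If [z] agreed with [y] on the tight set [T], then [incr n y] would violate the constraint of
   [T]. *)
have [j jT yzj] : exists2 j, j \in T & (y j < z j)%N.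
  apply/exists_inP; apply/contraT => /exists_inPn noj.
  move: Jyn; rewrite inE => /polymatroidP/(_ T).
  suff -> : load (incr n y) T = load z T + 1 by rewrite tT gerDl.
  rewrite load_incr nT; congr (_ + _); apply: eq_bigr => i /noj.
  by rewrite -leqNgt => zy; congr Posz; apply/eqP; rewrite eqn_leq yz zy.
pose x : {ffun 'I_N -> nat} := [ffun i => (z i - (i == j))%N].
have zE : z = incr j x.
  apply/ffunP => i; rewrite !ffunE; case: eqP => [->|_] /=; last by rewrite subn0 addn0.
  by move: yzj; lia.
exists j, x; split=> //; last first.
  move=> i; rewrite !ffunE leq_add2r; case: eqP => [->|_]; last by rewrite subn0.
  by move: yzj; lia.
(* Compared with [z], the load grows only on sets containing [n] but not [j]. Such a set does not
   include [T], so it is not tight and has slack at least 1. *)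
apply/polymatroidP => S; rewrite load_incr.
have /polymatroidP/(_ S) := zP; have := minT S.
rewrite /tight zE load_incr; case: (n \in S) => /=; last by case: (j \in S) => /=; lia.
case: (boolP (j \in S)) => [_ _|jS] /=; first by lia.
rewrite addr0 => /(_ isT) TS; rewrite le_eqVlt => /orP[/TS/fintype.subsetP/(_ j jT)|].
  by rewrite (negPf jS).
by lia.
Qed.

End Polymatroid.

(** * Optimality of the greedy runs *)

Section Greedy.
Import boot.finset.
Variables (R : realType) (N : nat) (F : {set 'I_N} -> int).
Variables (V : 'I_N -> seq R) (c : R).
Hypothesis subF : forall S T, F (S :|: T) + F (S :&: T) <= F S + F T.
Implicit Types (y z : {ffun 'I_N -> nat}) (n : 'I_N).

(** With [c := beta / M] this is the welfare of a feasible allocation. *)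
Definition shifted_value y : R :=
  \sum_(n < N) \sum_(1 <= m < (y n).+1) (bid V n m + c).

Lemma shifted_value_incr n y :
  shifted_value (incr n y) = shifted_value y + (bid V n (y n).+1 + c).
Proof.
rewrite /shifted_value (bigD1 n) //= [in RHS](bigD1 n) //= [in LHS]ffunE eqxx addn1.
rewrite big_nat_recr //= -!addrA; congr (_ + _); rewrite [RHS]addrC -addrA.
congr (_ + (_ + _)); apply: eq_bigr => i /negPf ni.
by rewrite ffunE ni addn0.
Qed.

Lemma shifted_valueE y : shifted_value y = OPT V y + c * (\sum_i y i)%N%:R.
Proof.
rewrite natr_sum mulr_sumr /OPT -big_split; apply: eq_bigr => n _ /=.
by rewrite big_split /= sumr_const_nat subn1 /= mulr_natr.
Qed.

Lemma greedy_from_feasible y y' :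
  greedy_from F V y y' -> y \in polymatroid F -> y' \in polymatroid F.
Proof. by elim=> // {}y n {}y' + _ _ IH _; rewrite inE => /IH. Qed.

Lemma greedy_from_maximal y y' :
  greedy_from F V y y' -> incrementable F y' = set0.
Proof. by elim. Qed.

(** Both hypotheses stop at [F [set n]], the length of [V n] in the application: beyond it [bid] is
    the default 0, which may exceed earlier, negative bids. *)
Hypothesis bid_ge0 : forall n k, k.+1%:Z <= F [set n] -> 0 <= bid V n k.+1 + c.
Hypothesis bid_decr : forall n k l, (k <= l)%N -> l.+1%:Z <= F [set n] ->
  bid V n l.+1 <= bid V n k.+1.

(** Induction on the run, with [z] varying; from the zero allocation the bound reaches every
    feasible [z]. *)
Lemma greedy_from_dominates y y' : greedy_from F V y y' ->
  forall z, z \in polymatroid F -> (forall i, (y i <= z i)%N) ->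
  shifted_value z <= shifted_value y'.
Proof.
elim=> {y y'} [y J0|y n y' Jn nmax _ IH] z zP yz.
  suff -> : z = y by [].
  apply/ffunP => i; apply/eqP; rewrite eqn_leq yz andbT leqNgt; apply/negP => yzi.
  have : i \in incrementable F y by rewrite inE (polymatroid_le (incr_ge yz yzi)).
  by rewrite J0 inE.
(* Either [z] already has the next unit of [n], or it can receive it at a nonnegative marginal, or
   it must give up a unit of [j]. *)
have [yzn|] := boolP (y n < z n)%N; first exact/IH/incr_ge.
rewrite -leqNgt => zyn; have {zyn} zn : z n = y n.
  by apply/eqP; rewrite eqn_leq zyn yz.
have [Jzn|Jzn] := boolP (n \in incrementable F z).
  move: Jzn; rewrite inE => z'P.
  apply: le_trans (IH _ z'P _); last by move=> i; rewrite !ffunE leq_add2r.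
  rewrite shifted_value_incr lerDl; apply: bid_ge0.
  by have := polymatroid_coord n z'P; rewrite ffunE eqxx addn1.
have [j [x [zE x'P yzj yx]]] := exchange subF zP yz zn Jn Jzn.
apply: le_trans (IH _ x'P yx).
have xj : z j = (x j).+1 by rewrite zE ffunE eqxx addn1.
have jn : n != j by apply: contraTneq yzj => <-; rewrite zn ltnn.
have xn : x n = y n by rewrite -zn zE ffunE (negPf jn) addn0.
rewrite zE !shifted_value_incr lerD2l lerD2r xn.
(* Greedy could have picked [j], since [incr j y] lies below [z]; and the unit given up comes no
   earlier in [V j] than the one greedy compared. *)
apply: le_trans (nmax j _); last first.
  by rewrite inE (polymatroid_le (incr_ge yz yzj)).
apply: bid_decr; first by rewrite -ltnS -xj.
by rewrite -xj polymatroid_coord.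
Qed.

End Greedy.

Theorem theorem3p8 (R : realType) (N : nat) (f : {set 'I_N} -> R) (M : int)
    (beta : R) (V : 'I_N -> seq R) (u : 'I_N -> R -> R)
    (ystar : {ffun 'I_N -> nat}) :
  (2 <= N)%N ->
  normalized f -> monotone f -> submodular f ->
  f finset.setT = 1 ->
  0 < min_distance f ->
  2 / min_distance f <= M%:~R ->
  0 < beta ->
  (forall n, (size (V n))%:Z = quantization f M (finset.set1 n)) ->
  (forall n, sorted (fun a b : R => b <= a) (V n)) ->
  (forall n, concave_function `[0, 1]%classic (u n)) ->
  (forall n, nondecreasing_on `[0, 1]%classic (u n)) ->
  (forall n (k : nat), k%:Z <= quantization f M (finset.set1 n) ->
     u n (k%:R / M%:~R)
     = \sum_(1 <= m < k.+1) bid V n m + beta * k%:R / M%:~R) ->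
  greedy_returns (quantization f M) V ystar ->
  [/\ optimal_solution (quantization f M) (welfare u M) ystar,
      max_value (quantization f M) (welfare u M) = welfare u M ystar &
      welfare u M ystar = OPT V ystar + beta].
Proof.
move=> _ f0 mf subf f1 d0 dM _ sizeV sortedV _ undec uE greedy.
set g := quantization f M in sizeV uE greedy *.
have M0 : 0 < M%:~R :> R by apply: lt_le_trans dM; rewrite divr_gt0.
have Mz0 : 0 < M by rewrite -(ltr0z R).
have subg S T : g (S :|: T) + g (S :&: T) <= g S + g T.
  exact: quantization_submodular.
have g0 : g finset.set0 = 0 by rewrite /g /quantization f0 mul0r floor0.
have gT : g finset.setT = M by rewrite /g /quantization f1 mul1r intrKfloor.
have gmono (S T : {set 'I_N}) : S \subset T -> g S <= g T.
  exact: quantization_monotone (ltW Mz0).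
pose c := beta / M%:~R.
(* A shifted bid is the increase of [u n] over a step of length [1 / M], inside [[0, 1]] because
   singletons have rank at most [M]. *)
have bid_ge0 n k : k.+1%:Z <= g (finset.set1 n) -> 0 <= bid V n k.+1 + c.
  move=> kg; have kM : k.+1%:Z <= M.
    by rewrite -gT; exact: le_trans kg (gmono _ _ (finset.subsetT _)).
  have kM' : k.+1%:R <= M%:~R :> R by rewrite -[k.+1%:R]/(k.+1%:Z%:~R) ler_int.
  have in01 l : (l <= k.+1)%N -> (l%:R / M%:~R : R) \in `[0, 1]%classic.
    move=> lk; apply/mem_set; rewrite /= in_itv /=; apply/andP.
    split; first exact: divr_ge0 (ler0n _ _) (ltW M0).
    by rewrite ler_pdivrMr // mul1r; apply: le_trans kM'; rewrite ler_nat.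
  have := undec n _ _ (in01 k (leqnSn k)) (in01 _ (leqnn _)).
  rewrite ler_pM2r ?invr_gt0 // ler_nat => /(_ (leqnSn k)).
  rewrite !uE //; last by apply: le_trans kg; rewrite lez_nat.
  rewrite (big_nat_recr k.+1) //= -!mulrA /c -[k.+1%:R]natr1 mulrDl mul1r mulrDr; lra.
have bid_decr n k l : (k <= l)%N -> l.+1%:Z <= g (finset.set1 n) ->
    bid V n l.+1 <= bid V n k.+1.
  rewrite -sizeV lez_nat /bid /= => kl lV.
  apply: (sorted_leq_nth _ _ _ (sortedV n)) => //.
  - by move=> a b d ba db; apply: le_trans db ba.
  - by rewrite inE; apply: leq_ltn_trans lV.
have zeroP : [ffun => 0%N] \in polymatroid g.
  apply/polymatroidP => S; rewrite /load big1 => [|i _]; last by rewrite ffunE.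
  by rewrite -g0 gmono // finset.sub0set.
have yP := greedy_from_feasible greedy zeroP.
(* Feasibility bounds each [z n] by its singleton rank, the range where [uE] applies. *)
have welfareE z : z \in polymatroid g -> welfare u M z = shifted_value V c z.
  move=> zP; rewrite /welfare; apply: eq_bigr => n _.
  rewrite uE ?polymatroid_coord // big_split /= sumr_const_nat subn1 /=.
  by rewrite -(mulr_natr c) /c mulrAC.
have opt : optimal_solution g (welfare u M) ystar.
  split=> // z zP; rewrite !welfareE //.
  apply: (greedy_from_dominates subg bid_ge0 bid_decr greedy) => // i.
  by rewrite ffunE.
split=> //.
  apply/eqP; rewrite eq_le; apply/andP; split.
    apply: ge_sup; first by exists (welfare u M ystar), ystar.
    by move=> _ [z zP ->]; apply: opt.2.
  apply: ub_le_sup; last by exists ystar.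
  by exists (welfare u M ystar) => _ [z zP ->]; apply: opt.2.
(* Tightness of the ground set means that exactly [M] units are allocated, so the shifts [c] add up
   to [beta]. *)
have /eqP := tight_setT_of_maximal subg g0 yP (greedy_from_maximal greedy).
rewrite gT /load => sumM.
have {sumM} sumM : (\sum_i ystar i)%N%:R = M%:~R :> R.
  rewrite -sumM natr_sum rmorph_sum; apply: eq_big => // i.
  by rewrite finset.in_setT.
by rewrite welfareE // shifted_valueE sumM /c divfK // gt_eqF.
Qed.
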